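(* Fix a (finite) Kuhn decision tree with real payoffs at terminal nodes and a probability measure on Nature's states. For each family of finite non-empty signal sets $(\Omega_I)_I$ and each signal structure $(\mathrm{Pr}_\sigma)_\sigma$ satisfying classicality, the highest expected payoff the team can achieve with these signals is the same as that without signals, i.e. $\max_f \Pi(f) = \max_{m} \pi(m)$, where $f$ ranges over strategy profiles in the tree extended by signals and $m$ ranges over strategy profiles in the underlying tree.
   Context: Kuhn decision tree: a finite rooted tree whose non-terminal nodes are partitioned into decision nodes (of the decision maker, i.e. the team) and chance nodes (of Nature). Decision nodes are partitioned into information sets $I$, and chance nodes into information sets $J$, such that (i) all nodes in the same information set have the same number of outgoing branches, with a given 1-1 correspondence between the outgoing branches of different nodes of the set (so each $I$ has a well-defined set $M_I$ of moves, and likewise each $J$); (ii) every path from the root to a terminal node crosses each information set at most once. Each terminal node $z$ carries a real payoff $u(z)$. A state of Nature $\psi$ selects a move at each information set $J$ of Nature; a probability measure $\nu$ on the finite set of states is given. For a terminal node $z$, write $\nu(z)$ for the $\nu$-probability of the set of states that select, at every chance node on the path to $z$, the branch on that path. Without signals: a strategy profile is $m = (m_I)_I \in \prod_I M_I$. Together with a state $\psi$ it induces a unique path to a terminal node; $\pi(m)$ is the $\nu$-expectation of the payoff at that terminal node. Sequences: for a terminal node $z$, let $\sigma(z) = I_{i_1}\cdots I_{i_K}$ be the (possibly empty) sequence of information sets of the team crossed, in order, by the path from the root to $z$. These are the sequences that arise in the tree. Signal structure: an assignment, to each sequence $\sigma = I_{i_1}\cdots I_{i_K}$ that arises in the tree,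 of a probability measure $\mathrm{Pr}_\sigma$ on $\Omega_{I_{i_1}}\times\cdots\times\Omega_{I_{i_K}}$. Classicality: there is a probability measure $\mu$ on $\Omega = \prod_I \Omega_I$ (product over all information sets of the team) such that for each sequence $\sigma = I_{i_1}\cdots I_{i_K}$ that arises in the tree, $\mathrm{Pr}_\sigma$ is the marginal of $\mu$ on $\Omega_{I_{i_1}}\times\cdots\times\Omega_{I_{i_K}}$. With signals: a strategy profile is a tuple $f = (f_I)_I$ of maps $f_I : \Omega_I \to M_I$. Nature and signals are independent, so the expected payoff is $$\Pi(f) = \sum_{z} \nu(z)\, \mathrm{Pr}_{\sigma(z)}\big(\{(\omega_I)_{I\in\sigma(z)} : f_I(\omega_I) = m_I^z \text{ for all } I \in \sigma(z)\}\big)\, u(z),$$ where $z$ ranges over terminal nodes and $m_I^z$ is the move at $I$ taken by the path to $z$. *)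

(* Defs.v *)
From HB Require Import structures.
From mathcomp Require Import all_boot all_order all_algebra.
From mathcomp Require Import reals.

Set Implicit Arguments.
Unset Strict Implicit.
Unset Printing Implicit Defensive.

Import Order.TTheory GRing.Theory Num.Theory.
Local Open Scope ring_scope.

(* A probability measure on a finite set, given by its point masses. *)
Record fdist (R : realType) (T : finType) := FDist {
  pmf :> T -> R;
  pmf_ge0 : forall x, 0 <= pmf x;
  pmf_sum1 : \sum_x pmf x = 1 }.

Definition prob (R : realType) (T : finType) (P : fdist R T) (A : {set T}) : R :=
  \sum_(x in A) P x.

Definition is_max (R : realType) (S : Type) (F : S -> R) (v : R) : Prop :=
  (exists s, F s = v) /\ (forall s, F s <= v).

Section Tree.
Variables (R : realType) (D C : finType) (M : D -> finType) (N : C -> finType).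

(* D and C are the information sets of the team and of Nature.  A node belongs
   to the information set it is labelled with; branches are labelled by the
   moves of that set, which gives the correspondence between the branches of
   the different nodes of an information set. *)
Inductive tree : Type :=
  | Leaf of R
  | Decision (I : D) of (M I -> tree)
  | Chance (J : C) of (N J -> tree).

Fixpoint terminal (t : tree) : finType :=
  match t with
  | Leaf _ => unit
  | Decision i c => {a : M i & terminal (c a)}
  | Chance j c => {a : N j & terminal (c a)}
  end.

Fixpoint payoff (t : tree) : terminal t -> R :=
  match t return terminal t -> R with
  | Leaf u => fun=> u
  | Decision i c => fun z => payoff (tagged z)
  | Chance j c => fun z => payoff (tagged z)
  end.

(* The (information set, move) pairs of the team, resp. of Nature, met in
   order on the path from the root to a terminal node. *)
Fixpoint team_path (t : tree) : terminal t -> seq {I : D & M I} :=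
  match t return terminal t -> seq {I : D & M I} with
  | Leaf _ => fun=> [::]
  | Decision i c => fun z => Tagged M (tag z) :: team_path (tagged z)
  | Chance j c => fun z => team_path (tagged z)
  end.

Fixpoint nature_path (t : tree) : terminal t -> seq {J : C & N J} :=
  match t return terminal t -> seq {J : C & N J} with
  | Leaf _ => fun=> [::]
  | Decision i c => fun z => nature_path (tagged z)
  | Chance j c => fun z => Tagged N (tag z) :: nature_path (tagged z)
  end.

Fixpoint play (m : forall I, M I) (psi : forall J, N J) (t : tree) : terminal t :=
  match t return terminal t with
  | Leaf _ => tt
  | Decision i c => Tagged (fun a => terminal (c a)) (play m psi (c (m i)))
  | Chance j c => Tagged (fun a => terminal (c a)) (play m psi (c (psi j)))
  end.

End Tree.

Record kuhn_tree (R : realType) := KuhnTree {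
  team_info : finType;
  nature_info : finType;
  team_move : team_info -> finType;
  nature_move : nature_info -> finType;
  root : tree R team_move nature_move;
  (* non-terminal nodes have outgoing branches *)
  team_move_gt0 : forall I, (0 < #|team_move I|)%N;
  nature_move_gt0 : forall J, (0 < #|nature_move J|)%N;
  (* information sets are blocks of a partition, hence non-empty *)
  team_info_occurs : forall I, exists z : terminal root, I \in map tag (team_path z);
  nature_info_occurs : forall J, exists z : terminal root, J \in map tag (nature_path z);
  team_path_uniq : forall z : terminal root, uniq (map tag (team_path z));
  nature_path_uniq : forall z : terminal root, uniq (map tag (nature_path z)) }.

Section Payoffs.
Variables (R : realType) (T : kuhn_tree R).

Definition state : finType := {dffun forall J : nature_info T, nature_move J}.

Definition strategy := forall I : team_info T, team_move I.

Definition expected_payoff (nu : fdist R state) (m : strategy) : R :=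
  \sum_(psi : state) nu psi * payoff (play m psi (root T)).

Definition terminal_prob (nu : fdist R state) (z : terminal (root T)) : R :=
  prob nu [set psi : state |
    all (fun s : {J : nature_info T & nature_move J} => psi (tag s) == tagged s)
        (nature_path z)].

Definition team_seq (z : terminal (root T)) : seq (team_info T) :=
  map tag (team_path z).

Definition arises (s : seq (team_info T)) : bool := s \in codom team_seq.

Lemma team_seq_arises (z : terminal (root T)) : arises (team_seq z).
Proof. exact: codom_f. Qed.

Variable Omega : team_info T -> finType.

Definition all_signals : finType := {dffun forall I : team_info T, Omega I}.

(* Product of the Omega I over the information sets I of s; the sequences that
   arise have no repetition, so the product may be indexed by the members of s. *)
Definition signals (s : seq (team_info T)) : finType :=
  {dffun forall i : seq_sub s, Omega (ssval i)}.

Definition restrict (s : seq (team_info T)) (w : all_signals) : signals s :=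
  [ffun i : seq_sub s => w (ssval i)].

Definition signal_structure :=
  forall s : seq (team_info T), arises s -> fdist R (signals s).

Definition classical (Pr : signal_structure) : Prop :=
  exists mu : fdist R all_signals,
    forall s (hs : arises s) (A : {set signals s}),
      prob (Pr s hs) A = prob mu [set w | restrict s w \in A].

Definition signal_strategy := forall I : team_info T, Omega I -> team_move I.

(* Signals for which f plays, at every information set on the path to z, the
   move of that path: since the path meets I at most once, (I, a) belongs to
   it exactly when a is its move at I. *)
Definition follows (f : signal_strategy) (z : terminal (root T)) :
    {set signals (team_seq z)} :=
  [set w : signals (team_seq z) | [forall i : seq_sub (team_seq z),
     Tagged (@team_move R T) (f (ssval i) (w i)) \in team_path z]].

Definition signal_expected_payoff (nu : fdist R state) (Pr : signal_structure)
    (f : signal_strategy) : R :=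
  \sum_(z : terminal (root T))
    terminal_prob nu z * prob (Pr (team_seq z) (team_seq_arises z)) (follows f z)
      * payoff z.

End Payoffs.

(* Main.v *)
(** Fix a realization [w] of all the signals, drawn according to the joint
    measure [mu] given by classicality: a profile [f] in the tree with signals
    then plays the pure profile [fun I => f I (w I)] of the underlying tree.
    Hence the payoff of [f] is the [mu]-average of payoffs of pure profiles, at
    most the best of them; profiles ignoring the signals attain this bound. *)
Require Import Defs.
From mathcomp Require Import all_boot all_order all_algebra.
From mathcomp Require Import reals.

Set Implicit Arguments.
Unset Strict Implicit.
Unset Printing Implicit Defensive.

Import Order.TTheory GRing.Theory Num.Theory.
Local Open Scope ring_scope.

(** Applied with [f] the tag: on a path crossing each information set at most once, the set
    determines the move. *)
Lemma uniq_map_inj (T U : eqType) (f : T -> U) (s : seq T) :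
  uniq (map f s) -> {in s &, injective f}.
Proof.
elim: s => //= x s IH /andP[fx /IH inj_f] y z; rewrite !inE.
case/predU1P=> [->|ys] /predU1P[->|zs] // eq_f; last exact: inj_f.
- by rewrite eq_f map_f in fx.
- by rewrite -eq_f map_f in fx.
Qed.

Definition consistent {I : finType} {M : I -> finType} (m : forall i, M i)
  (p : seq {i : I & M i}) : bool := all (fun s => m (tag s) == tagged s) p.

(** Separates the team's part of the event of reaching [z] from Nature's, by comparing moves node by
    node down the tree. *)
Lemma play_eq (R : realType) (D C : finType) (M : D -> finType)
    (N : C -> finType) (m : forall I, M I) (psi : forall J, N J)
    (t : tree R M N) (z : terminal t) :
  (play m psi t == z) =
    consistent m (team_path z) && consistent psi (nature_path z).
Proof.
elim: t z => [u|I c IH|J c IH] /=; first by case.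
- case=> a z /=; rewrite -tag_eqE /tag_eq /=.
  (* If the first moves agree, eliminating [eq_a] removes the transport between the two subtrees. *)
  case: eqVneq => [eq_a|//] /=; rewrite -IH; case: _ / eq_a z => z.
  by rewrite tagged_asE.
- case=> a z /=; rewrite -tag_eqE /tag_eq /=.
  case: eqVneq => [eq_a|//] /=; last by rewrite andbF.
  rewrite -IH; case: _ / eq_a z => z.
  by rewrite tagged_asE.
Qed.

Lemma eq_play (R : realType) (D C : finType) (M : D -> finType)
    (N : C -> finType) (m m' : forall I, M I) (psi : forall J, N J)
    (t : tree R M N) :
  (forall I, m I = m' I) -> play m psi t = play m' psi t.
Proof. by move=> mm'; elim: t => //= [I|J] c IH; rewrite ?mm' IH. Qed.

Section Payoff.
Variables (R : realType) (T : kuhn_tree R) (nu : fdist R (state T)).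

Lemma eq_expected_payoff (m m' : strategy T) :
  (forall I, m I = m' I) -> expected_payoff nu m = expected_payoff nu m'.
Proof. by move=> mm'; apply: eq_bigr => psi _; rewrite (eq_play _ _ mm'). Qed.

(** Sum over the terminal node reached, then exchange sums: by [play_eq], the team's condition does
    not involve [psi], and averaging Nature's condition gives [terminal_prob]. *)
Lemma expected_payoffE (m : strategy T) :
  expected_payoff nu m =
    \sum_z terminal_prob nu z * (consistent m (team_path z))%:R * payoff z.
Proof.
transitivity (\sum_(psi : state T) \sum_(z : terminal (Defs.root T))
    nu psi * (play m psi (Defs.root T) == z)%:R * payoff z).
  apply: eq_bigr => psi _.
  rewrite (bigD1 (play m psi (Defs.root T))) //= eqxx mulr1 big1 ?addr0 // => z.
  by rewrite eq_sym => /negPf->; rewrite mulr0 mul0r.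
rewrite exchange_big; apply: eq_bigr => z _ /=.
rewrite /terminal_prob /prob !mulr_suml [RHS]big_mkcond; apply: eq_bigr => psi _.
rewrite inE -/(consistent psi _) play_eq andbC.
by case: ifP => _ //=; rewrite mulr0 mul0r.
Qed.

Lemma expected_payoff_max : exists m, is_max (expected_payoff nu) (expected_payoff nu m).
Proof.
(* The maximum is taken over the finite type of finite functions, which represents every strategy up
   to pointwise equality; [m0] shows that it is inhabited. *)
pose m0 : {dffun forall I : team_info T, team_move I} :=
  [ffun I => enum_val (Ordinal (team_move_gt0 I))].
pose F (m : {dffun forall I : team_info T, team_move I}) := expected_payoff nu m.
case: (@arg_maxP _ _ _ m0 xpredT F) => // m _ mP.
exists m; split=> [|m']; first by exists m.
rewrite (@eq_expected_payoff m' [ffun I => m' I]); first exact: mP.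
by move=> I; rewrite ffunE.
Qed.

Variable Omega : team_info T -> finType.

Lemma restrict_follows (f : signal_strategy Omega) (z : terminal (Defs.root T))
    (w : all_signals Omega) :
  (restrict (team_seq z) w \in follows f z) =
    consistent (fun I => f I (w I)) (team_path z).
Proof.
rewrite inE; apply/forallP/allP => [fP [I a] Ia | fP i] /=.
  have Iz : I \in team_seq z by apply/mapP; exists (Tagged (@team_move R T) a).
  have := fP (SeqSub Iz); rewrite ffunE /= => If.
  (* Both the move played at [I] and [a] occur on the path with tag [I], hence coincide. *)
  have eq_aI := uniq_map_inj (team_path_uniq z) If Ia erefl.
  by move/eqP: eq_aI; rewrite -tag_eqE /tag_eq /= eqxx /= tagged_asE.
rewrite ffunE; case: i => I /= /mapP[[I' a] Ia /= ->].
by have /eqP /= -> := fP _ Ia.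
Qed.

(** Classicality puts the events of all terminal nodes on the one space of [mu], so the sums over
    [z] and [w] can be exchanged. *)
Lemma signal_expected_payoffE (mu : fdist R (all_signals Omega))
    (Pr : signal_structure Omega) (f : signal_strategy Omega) :
  (forall s (hs : arises s) (A : {set signals Omega s}),
      prob (Pr s hs) A = prob mu [set w | restrict s w \in A]) ->
  signal_expected_payoff nu Pr f =
    \sum_w mu w * expected_payoff nu (fun I => f I (w I)).
Proof.
move=> PrE.
under [RHS]eq_bigr => w _ do rewrite expected_payoffE mulr_sumr.
rewrite [RHS]exchange_big /signal_expected_payoff; apply: eq_bigr => z _ /=.
rewrite PrE /prob mulr_sumr mulr_suml big_mkcond; apply: eq_bigr => w _.
rewrite inE restrict_follows [_ * mu w]mulrC.
case: ifP => _; first by rewrite mulr1 mulrA.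
by rewrite mulr0 mul0r mulr0.
Qed.

End Payoff.

Theorem proposition5p2 (R : realType) (T : kuhn_tree R) (nu : fdist R (state T))
    (Omega : team_info T -> finType) (Omega_gt0 : forall I, (0 < #|Omega I|)%N)
    (Pr : signal_structure Omega) (Pr_classical : classical Pr) :
  exists v : R,
    is_max (signal_expected_payoff nu Pr) v /\ is_max (expected_payoff nu) v.
Proof.
have [mu PrE] := Pr_classical; have [m m_max] := expected_payoff_max nu.
exists (expected_payoff nu m); split=> //; have [_ le_m] := m_max.
(* Serves twice: as the payoff of the signal-blind profile [fun I _ => m I], and as the upper bound
   for any [f]. *)
have avg : \sum_w mu w * expected_payoff nu m = expected_payoff nu m.
  by rewrite -mulr_suml pmf_sum1 mul1r.
split=> [|f]; first by exists (fun I _ => m I); rewrite (signal_expected_payoffE _ _ PrE).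
rewrite (signal_expected_payoffE _ _ PrE) -avg.
by apply: ler_sum => w _; apply: ler_wpM2l; [exact: pmf_ge0 | exact: le_m].
Qed.
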